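(* Let $R$ be an integral domain. The following conditions are equivalent: (i) $R$ is an almost Krull domain satisfying the $t\#$-property; (ii) $R$ is an almost Krull domain satisfying the $t\#\#$-property; (iii) $R$ is a Krull domain.
   Context: $R$ is an integral domain with quotient field $K\neq R$. For a nonzero fractional ideal $I$, $I_v=(R:(R:I))$ where $(R:I)=\{x\in K: xI\subseteq R\}$, and $I_t=\bigcup\{J_v: J\subseteq I\text{ nonzero finitely generated}\}$; $I$ is a $t$-ideal if $I=I_t$; a $t$-prime is a prime $t$-ideal; $t\text{-Max}(R)$ is the set of ideals maximal among proper $t$-ideals. $R$ is almost Krull if $R_M$ is a rank-one discrete valuation domain for each $M\in t\text{-Max}(R)$. $R$ has the $t\#$-property if $\bigcap_{M\in\mathcal M_1}R_M\neq\bigcap_{M\in\mathcal M_2}R_M$ for any two distinct subsets $\mathcal M_1,\mathcal M_2$ of $t\text{-Max}(R)$. $R$ has the $t\#\#$-property if $\bigcap_{P\in\mathcal P_1}R_P\neq\bigcap_{P\in\mathcal P_2}R_P$ for any two distinct sets $\mathcal P_1,\mathcal P_2$ of pairwise incomparable $t$-prime ideals. *)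

(* Defs.v *)
(* An integral domain is modelled as a subring A of a field K
   whose quotient field is K; all ideals, fractional ideals and overrings
   (localizations) are subsets of K. *)
From mathcomp Require Import all_boot all_order all_algebra.
From Stdlib Require Import List.
Set Implicit Arguments. Unset Strict Implicit. Unset Printing Implicit Defensive.
Import Order.TTheory GRing.Theory Num.Theory.
Local Open Scope ring_scope.

Section Defs.
Variable K : fieldType.
Implicit Types (A I J V : K -> Prop).

Definition subring A : Prop :=
  A 0 /\ A 1 /\ (forall x y, A x -> A y -> A (x - y)) /\
  (forall x y, A x -> A y -> A (x * y)).

Definition quotient_field_of A : Prop :=
  forall x : K, exists a b, A a /\ A b /\ b != 0 /\ x = a / b.

Definition is_ideal A I : Prop :=
  (forall x, I x -> A x) /\ I 0 /\
  (forall x y, I x -> I y -> I (x + y)) /\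
  (forall r x, A r -> I x -> I (r * x)).

Definition nonzero_set I : Prop := exists x, I x /\ x != 0.

Definition colon A I : K -> Prop := fun x => forall y, I y -> A (x * y).

Definition vclos A I : K -> Prop := colon A (colon A I).

Fixpoint gen A (l : list K) : K -> Prop :=
  match l with
  | nil => fun x => x = 0
  | a :: l' => fun x => exists r y, A r /\ gen A l' y /\ x = r * a + y
  end.

Definition tclos A I : K -> Prop := fun x =>
  exists l : list K, (forall a, In a l -> I a) /\
    (exists a, In a l /\ a != 0) /\ vclos A (gen A l) x.

Definition is_t_ideal A I : Prop :=
  is_ideal A I /\ nonzero_set I /\ (forall x, I x <-> tclos A I x).

Definition is_prime_ideal A P : Prop :=
  is_ideal A P /\ ~ P 1 /\
  (forall a b, A a -> A b -> P (a * b) -> P a \/ P b).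

Definition is_t_prime A P : Prop := is_prime_ideal A P /\ is_t_ideal A P.

Definition is_t_max A M : Prop :=
  is_t_ideal A M /\ ~ M 1 /\
  (forall J, is_t_ideal A J -> ~ J 1 -> (forall x, M x -> J x) ->
     forall x, J x -> M x).

Definition localization A P : K -> Prop := fun x =>
  exists a s, A a /\ A s /\ ~ P s /\ x = a / s.

Definition discrete_valuation (v : K -> int) : Prop :=
  (forall x y, x != 0 -> y != 0 -> v (x * y) = v x + v y) /\
  (forall x y, x != 0 -> y != 0 -> x + y != 0 ->
     Num.min (v x) (v y) <= v (x + y)) /\
  (exists x, x != 0 /\ v x = 1).

Definition val_ring (v : K -> int) : K -> Prop := fun x => x = 0 \/ 0 <= v x.

Definition is_DVR V : Prop :=
  exists v, discrete_valuation v /\ forall x, V x <-> val_ring v x.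

Definition almost_Krull A : Prop :=
  forall M, is_t_max A M -> is_DVR (localization A M).

Definition inter_loc A (F : (K -> Prop) -> Prop) : K -> Prop :=
  fun x => forall P, F P -> localization A P x.

Definition same_set (X Y : K -> Prop) : Prop := forall x, X x <-> Y x.

Definition distinct_families (F1 F2 : (K -> Prop) -> Prop) : Prop :=
  exists P, (F1 P /\ ~ F2 P) \/ (F2 P /\ ~ F1 P).

Definition t_sharp A : Prop :=
  forall F1 F2 : (K -> Prop) -> Prop,
    (forall M, F1 M -> is_t_max A M) -> (forall M, F2 M -> is_t_max A M) ->
    distinct_families F1 F2 ->
    ~ same_set (inter_loc A F1) (inter_loc A F2).

Definition pairwise_incomparable (F : (K -> Prop) -> Prop) : Prop :=
  forall P Q, F P -> F Q -> (forall x, P x -> Q x) -> forall x, Q x -> P x.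

Definition t_sharp_sharp A : Prop :=
  forall F1 F2 : (K -> Prop) -> Prop,
    (forall P, F1 P -> is_t_prime A P) -> (forall P, F2 P -> is_t_prime A P) ->
    pairwise_incomparable F1 -> pairwise_incomparable F2 ->
    distinct_families F1 F2 ->
    ~ same_set (inter_loc A F1) (inter_loc A F2).

Definition Krull A : Prop :=
  exists F : (K -> int) -> Prop,
    (forall v, F v -> discrete_valuation v) /\
    (forall x, A x <-> forall v, F v -> val_ring v x) /\
    (forall x, x != 0 -> exists l : list (K -> int),
        forall v, F v -> v x != 0 -> In v l).

End Defs.

(* Main.v *)
(** (i) => (iii): by Zorn, [A] is the intersection of the [A_M], [M] t-maximal.
    For finite character, let [a != 0] in [A] and let [I] be the set of the [b]
    in [A] with [b / a] in [A_M] for all but finitely many [M].  It is a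
    t-ideal, and if it were proper it would lie in a t-maximal [N].  The
    t#-property gives [x] with [v_N x = - k < 0] and [v_M x >= 0] for
    [M <> N]; then [a ^ k * x ^ (v_N a)] lies in [I] but not in [N].  So
    [1 / a] is in [A_M] for almost all [M].

    (iii) => (ii): for a t-prime [P] of a Krull domain, finite character gives a
    finitely generated [J] inside [P] with [(A : J) = (A : P)], so [(A : P)] is
    not contained in [A]; by complete integral closedness [x P] is not contained
    in [P] for some [x] in [(A : P)].  Then [P A_P] is principal and [A_P] is
    the ring of one of the given valuations.  Hence t-primes are pairwise
    incomparable, and [x] lies in [A_Q] for every t-prime [Q] other than [P],
    but not in [A_P]. *)
Require Import Defs.
From mathcomp Require Import all_boot all_order all_algebra.
From mathcomp Require Import ring zify.
From mathcomp Require Import boolp classical_sets.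

Set Implicit Arguments.
Unset Strict Implicit.
Unset Printing Implicit Defensive.
Import Order.TTheory GRing.Theory Num.Theory.
Local Open Scope ring_scope.

(** * Arithmetic of discrete valuations *)

Section DiscreteValuation.
Variables (K : fieldType) (v : K -> int).
Hypothesis dv : discrete_valuation v.

Lemma valM x y : x != 0 -> y != 0 -> v (x * y) = v x + v y.
Proof. by case: dv => + _; apply. Qed.

Lemma val1 : v 1 = 0.
Proof.
have := valM (oner_neq0 K) (oner_neq0 K); rewrite mulr1.
by move: (v 1) => w; lia.
Qed.

Lemma valV x : x != 0 -> v x^-1 = - v x.
Proof.
move=> x0; have := valM x0 (invr_neq0 x0).
by rewrite divff // val1; lia.
Qed.

Lemma valX x n : x != 0 -> v (x ^+ n) = v x * n%:Z.
Proof.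
move=> x0; elim: n => [|n IHn]; first by rewrite expr0 val1 mulr0.
by rewrite exprS valM ?expf_neq0 // IHn; lia.
Qed.

Lemma val_ring_ge0 x : x != 0 -> val_ring v x <-> 0 <= v x.
Proof. by move=> /eqP x0; split=> [[]|] //; right. Qed.

End DiscreteValuation.

Section Subring.
Variables (K : fieldType) (A : K -> Prop).
Hypothesis hA : subring A.

Lemma subr_0 : A 0. Proof. by case: hA. Qed.
Lemma subr_1 : A 1. Proof. by case: hA => _ []. Qed.
Lemma subr_M x y : A x -> A y -> A (x * y).
Proof. by case: hA => _ [_ [_]]; apply. Qed.
Lemma subr_B x y : A x -> A y -> A (x - y).
Proof. by case: hA => _ [_ [+ _]]; apply. Qed.
Lemma subr_D x y : A x -> A y -> A (x + y).
Proof.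
move=> Ax Ay; rewrite -[y]opprK; apply: subr_B => //.
by rewrite -sub0r; apply: subr_B => //; exact: subr_0.
Qed.
Lemma subr_X x n : A x -> A (x ^+ n).
Proof.
move=> Ax; elim: n => [|n IHn]; first by rewrite expr0; exact: subr_1.
by rewrite exprS; apply: subr_M.
Qed.

End Subring.

(** * Finitely generated ideals, t-ideals and t-maximal ideals *)

Section Domain.
Variables (K : fieldType) (A : K -> Prop).
Hypotheses (hA : subring A) (hK : quotient_field_of A).

Lemma gen_mem (l : list K) a : List.In a l -> gen A l a.
Proof.
elim: l => //= b l IHl [->|/IHl la].
  exists 1, 0; split; [exact: (subr_1 hA)|split; last by rewrite mul1r addr0].
  elim: l {IHl} => //= c l IHl; exists 0, 0; split; first exact: (subr_0 hA).
  by split=> //; rewrite mul0r addr0.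
by exists 0, a; split; [exact: (subr_0 hA)|split=> //; rewrite mul0r add0r].
Qed.

Lemma colon_gen (l : list K) x :
  colon A (gen A l) x <-> forall a, List.In a l -> A (x * a).
Proof.
split=> [xl a /gen_mem|]; first exact: xl.
elim: l => [|b l IHl] /= xl y.
  by move=> ->; rewrite mulr0; exact: (subr_0 hA).
case=> r [z [Ar [lz ->]]]; rewrite mulrDr; apply: (subr_D hA).
  by rewrite mulrCA; apply: (subr_M hA) => //; apply: xl; left.
by apply: IHl lz => a la; apply: xl; right.
Qed.

Lemma vclos_gen (l : list K) y : vclos A (gen A l) y <->
  forall x, (forall a, List.In a l -> A (x * a)) -> A (y * x).
Proof. by split=> yl x /colon_gen; exact: yl. Qed.

(** Only the closure under v-closures of finite lists needs checking. The other inclusion is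
    automatic: [x] lies in the v-closure of the ideal generated by [x] and [c], where [c] makes the
    list nonzero even for [x = 0]. *)
Lemma is_t_ideal_intro (I : K -> Prop) : is_ideal A I -> nonzero_set I ->
  (forall l y, (forall a, List.In a l -> I a) ->
    (exists a, List.In a l /\ a != 0) ->
    (forall x, (forall a, List.In a l -> A (x * a)) -> A (y * x)) -> I y) ->
  is_t_ideal A I.
Proof.
move=> idI [c [Ic c0]] clI; split=> //; split; first by exists c.
move=> x; split=> [Ix|[l [lI [l0 /vclos_gen xl]]]]; last exact: clI lI l0 xl.
exists [:: x; c]; split; first by move=> a /= [<-|[<-|]].
split; first by exists c; split=> //; right; left.
by apply/vclos_gen => z zl; rewrite mulrC; apply: zl; left.
Qed.

Lemma t_ideal_vclos (I : K -> Prop) l y : is_t_ideal A I ->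
  (forall a, List.In a l -> I a) -> (exists a, List.In a l /\ a != 0) ->
  (forall x, (forall a, List.In a l -> A (x * a)) -> A (y * x)) -> I y.
Proof.
move=> [_ [_ clI]] lI l0 yl; apply/clI; exists l; split=> //; split=> //.
exact/vclos_gen.
Qed.

(** Both [1] and [x] multiply this ideal into [A], hence also its finite v-closures. A denominator
    of [x] is a nonzero element. *)
Lemma denominator_t_ideal x : is_t_ideal A (fun a => A a /\ A (a * x)).
Proof.
apply: is_t_ideal_intro.
- split; first by move=> ? [].
  split; first by rewrite mul0r; split; exact: (subr_0 hA).
  split=> [a b [Aa Aax] [Ab Abx]|r a Ar [Aa Aax]].
    by rewrite mulrDl; split; apply: (subr_D hA).
  by rewrite -mulrA; split; apply: (subr_M hA).
- have [a [b [Aa [Ab [b0 xE]]]]] := hK x; exists b; split=> //; split=> //.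
  by rewrite xE mulrC divfK.
- move=> l y lI _ yl; split.
    by rewrite -[y]mulr1; apply: yl => a /lI [Aa _]; rewrite mul1r.
  by apply: yl => a /lI [_]; rewrite mulrC.
Qed.

Lemma chain_list (F : (K -> Prop) -> Prop) (l : list K) :
  (exists J, F J) -> total_on F subset ->
  (forall a, List.In a l -> exists2 J : K -> Prop, F J & J a) ->
  exists2 J, F J & forall a, List.In a l -> J a.
Proof.
move=> [J0 FJ0] totF; elim: l => [|a l IHl] lF; first by exists J0.
have [J FJ lJ] : exists2 J, F J & forall a, List.In a l -> J a.
  by apply: IHl => b lb; apply: lF; right.
have [J' FJ' J'a] := lF a (or_introl erefl).
have [JJ'|J'J] := totF _ _ FJ FJ'.
  by exists J' => // b [<-//|/lJ]; exact: JJ'.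
by exists J => // b [<-|/lJ //]; exact: J'J.
Qed.

(** Being a t-ideal is tested on finite lists, and such a list from the union of a chain already
    lies in one member. *)
Lemma chain_t_ideal (F : (K -> Prop) -> Prop) :
  (exists J, F J) -> total_on F subset -> (forall J, F J -> is_t_ideal A J) ->
  is_t_ideal A (fun x => exists2 J : K -> Prop, F J & J x).
Proof.
move=> F0 totF tF; have [J0 FJ0] := F0; apply: is_t_ideal_intro.
- split; first by move=> x [J /tF [[JA _] _]]; exact: JA.
  split; first by exists J0 => //; have [[_ [+ _]] _] := tF _ FJ0.
  split=> [x y xF yF|r x Ar [J FJ Jx]].
    have [J FJ Jxy] : exists2 J, F J & forall a, List.In a [:: x; y] -> J a.
      by apply: chain_list => // a /= [<-|[<-|]].
    exists J => //; have [[_ [_ [JD _]]] _] := tF _ FJ.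
    by apply: JD; apply: Jxy => /=; auto.
  by exists J => //; have [[_ [_ [_ JM]]] _] := tF _ FJ; exact: JM.
- by have [_ [[c [Jc c0]] _]] := tF _ FJ0; exists c; split=> //; exists J0.
- move=> l y /(chain_list F0 totF) [J FJ lJ] l0 yl; exists J => //.
  exact: t_ideal_vclos (tF _ FJ) lJ l0 yl.
Qed.

Lemma t_ideal_sub_t_max (I : K -> Prop) : is_t_ideal A I -> ~ I 1 ->
  exists2 M, is_t_max A M & forall x, I x -> M x.
Proof.
move=> tI I1.
(* The empty set is admitted because of the empty chain. *)
pose P (J : K -> Prop) := (exists x, J x) ->
  [/\ is_t_ideal A J, ~ J 1 & forall x, I x -> J x].
have [F FP totF|M [PM maxM]] := @Zorn_bigcup K P.
  case=> x [J0 FJ0 J0x].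
  pose G J := F J /\ exists x, J x.
  have GJ0 : G J0 by split=> //; exists x.
  have -> : (\bigcup_(X in F) X)%classic = (fun x => exists2 J, G J & J x).
    apply/funext => z; apply/propext; split=> [[J FJ Jz]|[J [FJ _] Jz]].
      by exists J => //; split=> //; exists z.
    by exists J.
  have GP J : G J -> [/\ is_t_ideal A J, ~ J 1 & forall x, I x -> J x].
    by case=> /FP; exact.
  split.
  - apply: chain_t_ideal; first by exists J0.
      by move=> ? ? [? _] [? _]; exact: totF.
    by move=> J /GP [].
  - by case=> J /GP [].
  - by move=> z Iz; exists J0 => //; have [_ _] := GP _ GJ0; apply.
have [c [Ic c0]] : nonzero_set I by case: tI => _ [].
have [Mx|M0] := pselect (exists x, M x); last first.
  have PI : P I by [].
  by case: (maxM I) => //; split=> [x Mx|/(_ c Ic) Mc]; case: M0; [exists x|exists c].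
have [tM M1 IM] := PM Mx; exists M => //; split=> //; split=> // J tJ J1 MJ x Jx.
apply/not_notP => nMx; apply: (maxM J); first by split=> // /(_ _ Jx).
by move=> _; split=> // z /IM /MJ.
Qed.

(** For [a] in [A] outside [M], the elements [x] of [A] with [a * x] in [M] form a proper t-ideal
    containing [M], hence equal to [M] by maximality. *)
Lemma t_max_prime (M : K -> Prop) : is_t_max A M -> is_t_prime A M.
Proof.
move=> [tM [M1 maxM]]; split=> //; have [idM [[c [Mc c0]] _]] := tM.
split=> //; split=> // a b Aa Ab Mab; have [Ma|nMa] := pselect (M a); [by left|right].
have [MA [M0 [MD MM]]] := idM.
apply: (maxM (fun x => A x /\ M (a * x))) => //; first last.
- by move=> x Mx; split; [exact: MA|exact: MM].
- by rewrite mulr1 => -[].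
apply: is_t_ideal_intro.
- split; first by move=> ? [].
  split; first by rewrite mulr0; split=> //; exact: (subr_0 hA).
  split=> [x y [Ax Mx] [Ay My]|r x Ar [Ax Mx]].
    by rewrite mulrDr; split; [exact: (subr_D hA)|exact: MD].
  by rewrite mulrCA; split; [exact: (subr_M hA)|exact: MM].
- by exists c; split=> //; split; [exact: MA|exact: MM].
move=> l y lI [d [ld d0]] yl.
have Ay : A y by rewrite -[y]mulr1; apply: yl => e /lI [Ae _]; rewrite mul1r.
split=> //; have [a0|a0] := eqVneq a 0; first by rewrite a0 mul0r.
(* Multiplying the generators and [y] by [a] reduces the claim to the closedness of [M]. *)
apply: (@t_ideal_vclos _ (map (fun z => a * z) l) _ tM).
- by move=> _ /List.in_map_iff [z [<- /lI []]].
- by exists (a * d); rewrite mulf_neq0 //; split=> //; apply: List.in_map.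
move=> x xl; rewrite mulrAC mulrC [a * x]mulrC; apply: yl => e le.
by rewrite -mulrA; apply: xl; exact: List.in_map.
Qed.


(** * Localizations at prime ideals *)

Lemma prime_idealM (P : K -> Prop) s t : is_prime_ideal A P ->
  A s -> A t -> ~ P s -> ~ P t -> ~ P (s * t).
Proof. by move=> [_ [_ pP]] As At Ps Pt /pP[]. Qed.

Lemma prime_idealX (P : K -> Prop) x n : is_prime_ideal A P ->
  A x -> P (x ^+ n) -> P x.
Proof.
move=> hP Ax; have [_ [P1 pP]] := hP; elim: n => [|n IHn]; first by rewrite expr0.
by rewrite exprS => /pP[|||/IHn] //; exact: subr_X.
Qed.

Lemma locP (P : K -> Prop) x : is_prime_ideal A P ->
  localization A P x <-> exists s, [/\ A s, ~ P s & A (s * x)].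
Proof.
move=> [[_ [P0 _]] _]; split=> [[a [s [Aa [As [Ps ->]]]]]|[s [As Ps Asx]]];
    have s0 : s != 0 by apply: contra_not_neq Ps => ->.
  by exists s; split=> //; rewrite mulrC divfK.
by exists (s * x), s; rewrite mulrAC divff ?mul1r.
Qed.

Lemma sub_loc (P : K -> Prop) x : is_prime_ideal A P -> A x -> localization A P x.
Proof.
move=> hP Ax; apply/locP => //; exists 1; rewrite mul1r; split=> //.
  exact: (subr_1 hA).
by case: hP => _ [].
Qed.

Lemma loc_subring (P : K -> Prop) : is_prime_ideal A P -> subring (localization A P).
Proof.
move=> hP; split; first by apply: sub_loc => //; exact: (subr_0 hA).
split; first by apply: sub_loc => //; exact: (subr_1 hA).
split=> x y /(locP _ hP) [s [As Ps Asx]] /(locP _ hP) [t [At Pt Aty]];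
    apply/locP => //; exists (s * t).
  split; [exact: (subr_M hA)|exact: prime_idealM|].
  rewrite mulrBr {1}[s * t]mulrC -!mulrA.
  by apply: (subr_B hA) => //; apply: (subr_M hA).
by split; [exact: (subr_M hA)|exact: prime_idealM|rewrite mulrACA; exact: (subr_M hA)].
Qed.

Lemma loc_inv (P : K -> Prop) s : is_prime_ideal A P -> A s -> s != 0 ->
  localization A P s^-1 <-> ~ P s.
Proof.
move=> hP As s0; split=> [/(locP _ hP) [t [At Pt Ats]] Ps|Ps].
  apply: Pt; have [[_ [_ [_ PM]]] _] := hP.
  by rewrite -[t](divfK s0); exact: PM.
by apply/locP => //; exists s; rewrite divff //; split=> //; exact: (subr_1 hA).
Qed.

Lemma loc_common_denominator (P : K -> Prop) (l : list K) : is_prime_ideal A P ->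
  (forall b, List.In b l -> localization A P b) ->
  exists s, [/\ A s, ~ P s & forall b, List.In b l -> A (s * b)].
Proof.
move=> hP; elim: l => [_|b l IHl bl].
  by exists 1; split; [exact: (subr_1 hA)|case: hP => _ []|].
have [s [As Ps sl]] := IHl (fun c lc => bl c (or_intror lc)).
have /(locP _ hP) [t [At Pt Atb]] := bl b (or_introl erefl).
exists (s * t); split; [exact: (subr_M hA)|exact: prime_idealM|].
move=> c /= [<-|/sl Asc]; first by rewrite -mulrA; exact: (subr_M hA).
by rewrite mulrAC; exact: (subr_M hA).
Qed.

(** * Intersections of localizations at t-maximal ideals, and finite character from the
    t#-property *)

Lemma inter_loc_t_max x : inter_loc A (is_t_max A) x <-> A x.
Proof.
split=> [xM|Ax M /t_max_prime [hM _]]; last exact: sub_loc.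
apply/not_notP => nAx.
(* The denominator ideal of [x] is proper, so some t-maximal [M] contains every denominator of
   [x]. *)
have [M tM DM] : exists2 M, is_t_max A M & forall a, A a /\ A (a * x) -> M a.
  apply: (t_ideal_sub_t_max (denominator_t_ideal x)).
  by rewrite mul1r => -[].
have [hM _] := t_max_prime tM.
by have /(locP _ hM) [s [As Ms Asx]] := xM M tM; apply/Ms/DM.
Qed.

Lemma t_max_incomparable (M N : K -> Prop) : is_t_max A M -> is_t_max A N ->
  (forall x, M x -> N x) -> forall x, N x -> M x.
Proof. by move=> [_ [_ maxM]] [tN [N1 _]] MN; exact: maxM. Qed.

(** Families of t-maximal ideals are among the families compared by the t##-property. *)
Lemma t_sharp_sharp_sharp : t_sharp_sharp A -> t_sharp A.
Proof.
move=> tss F1 F2 tF1 tF2; apply: tss;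
  try by [move=> P /tF1/t_max_prime|move=> P /tF2/t_max_prime].
  by move=> P Q /tF1 ? /tF1 ?; exact: t_max_incomparable.
by move=> P Q /tF2 ? /tF2 ?; exact: t_max_incomparable.
Qed.

(** The t#-property is applied to all t-maximal ideals and to those other than [N]: without such an
    [x], both intersections would agree. *)
Lemma t_sharp_separates (N : K -> Prop) : t_sharp A -> is_t_max A N ->
  exists x, ~ localization A N x /\
    forall M, is_t_max A M -> M <> N -> localization A M x.
Proof.
move=> ts tN; apply/not_notP => nx.
apply: (ts (is_t_max A) (fun M => is_t_max A M /\ M <> N)); first by [].
- by move=> M [].
- by exists N; left; split=> // -[].
- move=> x; split=> [xA M [tM _]|xN M tM]; first exact: xA.
  have [-> {M tM}|MN] := pselect (M = N); last exact: xN.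
  by apply/not_notP => Nx; apply: nx; exists x; split=> // M tM MN; exact: xN.
Qed.

Lemma almost_everywhere_t_ideal a : A a -> a != 0 ->
  is_t_ideal A (fun b => A b /\ exists l : list (K -> Prop),
    forall M, is_t_max A M -> ~ localization A M (b / a) -> List.In M l).
Proof.
move=> Aa a0; apply: is_t_ideal_intro.
- split; first by move=> ? [].
  split.
    split; first exact: (subr_0 hA).
    exists nil => M /t_max_prime [hM _] []; rewrite mul0r.
    by apply: sub_loc => //; exact: (subr_0 hA).
  split=> [b c [Ab [l bl]] [Ac [l' cl']]|r b Ar [Ab [l bl]]].
    split; first exact: (subr_D hA).
    exists (l ++ l')%list => M tM nM; apply/List.in_app_iff.
    have [hM _] := t_max_prime tM.
    have [Mb|Mb] := pselect (localization A M (b / a)); last by left; exact: bl.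
    right; apply: cl' => // Mc; apply: nM; rewrite mulrDl.
    exact: (subr_D (loc_subring hM)).
  split; first exact: (subr_M hA).
  exists l => M tM nM; apply: bl => // Mb; apply: nM.
  have [hM _] := t_max_prime tM; rewrite -mulrA.
  by apply: (subr_M (loc_subring hM)) => //; exact: sub_loc.
- exists a; split=> //; split=> //; exists nil => M /t_max_prime [hM _] [].
  by rewrite divff //; apply: sub_loc => //; exact: (subr_1 hA).
- move=> l y lI _ yl; split.
    by rewrite -[y]mulr1; apply: yl => b /lI [Ab _]; rewrite mul1r.
  (* Joining the exceptional lists of the finitely many generators gives one list [L] for all of
     them. *)
  have {lI} [L Ll] : exists L : list (K -> Prop), forall b, List.In b l ->
      forall M, is_t_max A M -> ~ localization A M (b / a) -> List.In M L.
    elim: l lI {yl} => [|b l IHl] lI; first by exists nil.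
    have [L IHL] := IHl (fun c lc => lI c (or_intror lc)).
    have [_ [L' bL']] := lI b (or_introl erefl).
    exists (L' ++ L)%list => c /= cl M tM nM; apply/List.in_app_iff.
    by case: cl nM => [<-|cl] nM; [left; exact: bL'|right; exact: IHL nM].
  exists L => M tM nM; apply/not_notP => nL; apply: nM.
  have [hM _] := t_max_prime tM.
  (* Outside [L], a common denominator [s] of the [b / a] makes [s / a] carry all generators into
     [A], hence also [y]. *)
  have [s [As Ms sl]] : exists s,
      [/\ A s, ~ M s & forall b, List.In b (map (fun b => b / a) l) -> A (s * b)].
    apply: loc_common_denominator => // _ /List.in_map_iff [b [<- bl]].
    by apply/not_notP => nb; apply: nL; exact: Ll bl _ _ nb.
  apply/locP => //; exists s; split=> //.
  rewrite mulrCA; apply: yl => b bl.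
  by rewrite mulrAC -mulrA; apply: sl; apply/List.in_map_iff; exists b.
Qed.

Lemma almost_Krull_t_sharp_finite a : almost_Krull A -> t_sharp A ->
  A a -> a != 0 -> exists l : list (K -> Prop),
    forall M, is_t_max A M -> ~ localization A M a^-1 -> List.In M l.
Proof.
move=> aK ts Aa a0; have tI := almost_everywhere_t_ideal Aa a0.
have [[_ [l]]|I1] := pselect (A 1 /\ exists l : list (K -> Prop), forall M,
    is_t_max A M -> ~ localization A M (1 / a) -> List.In M l).
  by rewrite mul1r; exists l.
have [N tN IN] := t_ideal_sub_t_max tI I1.
have [hN _] := t_max_prime tN.
have [x [nNx xM]] := t_sharp_separates ts tN.
have [v [dv vN]] := aK _ tN.
have x0 : x != 0 by apply: contra_not_neq nNx => ->; apply/vN; left.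
have vx : v x < 0 by rewrite ltNge; apply/negP => vx; apply: nNx; apply/vN; right.
have va : 0 <= v a by apply/(val_ring_ge0 _ a0)/vN/sub_loc.
(* The exponents balance the nonnegative [v a] against the negative [v x], so that [v b = 0] and [b]
   is a unit at [N]. *)
pose b := a ^+ `|v x| * x ^+ `|v a|.
have b0 : b != 0 by rewrite mulf_neq0 ?expf_neq0.
have vb : v b = 0.
  rewrite /b (valM dv) ?expf_neq0 // !(valX dv) // (gez0_abs va) (ltz0_abs vx).
  by rewrite mulrN [v x * _]mulrC addNr.
have Mba M : is_t_max A M -> M <> N -> localization A M (b / a).
  move=> tM MN; have [hM _] := t_max_prime tM; rewrite /b mulrAC.
  apply: (subr_M (loc_subring hM)); last first.
    by apply: subr_X (loc_subring hM) _ _ _; exact: xM.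
  (* The exponent of [a] in [b] is positive, so one factor [a] cancels in [b / a]. *)
  have : (0 < `|v x|)%N by rewrite absz_gt0; apply: contraTneq vx => ->.
  case: `|v x|%N => // k _; rewrite exprSr mulfK //.
  by apply: sub_loc => //; exact: subr_X.
have Ab : A b.
  apply/inter_loc_t_max => M tM; have [hM _] := t_max_prime tM.
  have [-> |MN] := pselect (M = N); first by apply/vN; right; rewrite vb.
  rewrite -[b](divfK a0); apply: (subr_M (loc_subring hM)); first exact: Mba.
  exact: sub_loc.
have Nb : N b.
  apply: IN; split=> //; exists [:: N] => M tM nM; left.
  by apply/not_notP => NM; apply: nM; apply: Mba => // MN; apply: NM.
by case: (loc_inv hN Ab b0).1 => //; apply/vN; right; rewrite (valV dv) // vb.
Qed.

Lemma almost_Krull_t_sharp_Krull : almost_Krull A -> t_sharp A -> Krull A.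
Proof.
move=> aK ts.
have /choice [v vM] (M : K -> Prop) : exists w, is_t_max A M ->
    discrete_valuation w /\ forall x, localization A M x <-> val_ring w x.
  have [/aK [w wM]|nM] := pselect (is_t_max A M); first by exists w.
  (* A default value: the family below uses [v M] only for t-maximal [M]. *)
  by exists (fun=> 0).
exists (fun w => exists2 M, is_t_max A M & w = v M).
split; first by move=> _ [M tM ->]; case: (vM M tM).
split.
  move=> x; split=> [Ax _ [M tM ->]|xv].
    by apply/(vM M tM).2/sub_loc => //; case: (t_max_prime tM).
  by apply/inter_loc_t_max => M tM; apply/(vM M tM).2/xv; exists M.
(* For [a] in [A], a nonzero value is positive, so [a^-1] is not in the localization. A quotient is
   then handled by joining the lists of numerator and denominator. *)
have fin a : A a -> a != 0 -> exists l : list (K -> Prop),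
    forall M, is_t_max A M -> v M a != 0 -> List.In M l.
  move=> Aa a0; have [l al] := almost_Krull_t_sharp_finite aK ts Aa a0.
  exists l => M tM va; apply: al => //; have [dv vE] := vM M tM.
  move=> /vE /(val_ring_ge0 _ (invr_neq0 a0)); rewrite (valV dv) // => va'.
  have : 0 <= v M a.
    by apply/(val_ring_ge0 _ a0)/vE/sub_loc => //; case: (t_max_prime tM).
  by move: va va'; case: (v M a) => // -[].
move=> x x0; have [a [b [Aa [Ab [b0 xE]]]]] := hK x.
have a0 : a != 0 by apply: contraNneq x0 => a0; rewrite xE a0 mul0r.
have [l al] := fin a Aa a0; have [l' bl'] := fin b Ab b0.
exists (map v (l ++ l')%list) => _ [M tM ->] vx; apply/List.in_map/List.in_app_iff.
have [va|/al] := eqVneq (v M a) 0; last by left; auto.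
right; apply: bl' => //; apply: contraNneq vx => vb; have [dv _] := vM M tM.
by rewrite xE (valM dv) ?invr_neq0 // (valV dv) // va vb.
Qed.


(** * Krull domains, given by a family of discrete valuations of finite character *)

Section KrullFamily.
Variable F : (K -> int) -> Prop.
Hypotheses (dF : forall v, F v -> discrete_valuation v)
  (AF : forall x, A x <-> forall v, F v -> val_ring v x)
  (finF : forall x, x != 0 -> exists l : list (K -> int),
    forall v, F v -> v x != 0 -> List.In v l).

Lemma krull_val_ge0 v x : F v -> A x -> x != 0 -> 0 <= v x.
Proof. by move=> Fv /AF Ax x0; apply/(val_ring_ge0 _ x0)/Ax. Qed.

Lemma krull_memP x : x != 0 -> (forall v, F v -> 0 <= v x) -> A x.
Proof. by move=> x0 xF; apply/AF => v Fv; right; exact: xF. Qed.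

Lemma krull_notinP x : ~ A x -> x != 0 /\ exists2 v, F v & v x < 0.
Proof.
move=> nAx; have x0 : x != 0 by apply: contra_not_neq nAx => ->; exact: (subr_0 hA).
split=> //; apply/not_notP => nv; apply: nAx; apply: krull_memP => // v Fv.
by rewrite leNgt; apply/negP => vx; apply: nv; exists v.
Qed.

Lemma krull_completely_integrally_closed a x : A a -> a != 0 ->
  (forall n, A (x ^+ n * a)) -> A x.
Proof.
move=> Aa a0 xa; apply/not_notP => /krull_notinP [x0 [v Fv vx]].
(* Since [v x <= -1], the power [|v a| + 1] is large enough to make the value of the product
   negative. *)
have := krull_val_ge0 Fv (xa `|v a|.+1) (mulf_neq0 (expf_neq0 _ x0) a0).
rewrite (valM (dF Fv)) ?expf_neq0 // (valX (dF Fv)) //.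
by move: (v x) (v a) vx => i j; nia.
Qed.

Section TIdeal.
Variable I : K -> Prop.
Hypotheses (tI : is_t_ideal A I) (I1 : ~ I 1).

(** Values of [v] in [F] on nonzero elements of [I] are natural numbers, so a least one is attained;
    [lb] collects one minimizer for each valuation of [l] lying in [F]. *)
Lemma krull_t_ideal_minima (l : list (K -> int)) :
  exists lb : list K, (forall b, List.In b lb -> I b) /\
    forall v, List.In v l -> F v -> exists b, [/\ List.In b lb, b != 0 &
      forall q, I q -> q != 0 -> v b <= v q].
Proof.
have [[IA _] [[c [Ic c0]] _]] := tI.
elim: l => [|v l [lb [lbI lbP]]]; first by exists nil.
have [Fv|nFv] := pselect (F v); last first.
  by exists lb; split=> // w /= [<- //|]; exact: lbP.
pose R n := `[< exists q, [/\ I q, q != 0 & v q = n%:Z] >].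
have vI q : I q -> q != 0 -> R `|v q|%N.
  move=> Iq q0; apply/asboolP; exists q; split=> //.
  by rewrite gez0_abs // krull_val_ge0 //; exact: IA.
have exR : exists n, R n by exists `|v c|%N; exact: vI.
case: (ex_minnP exR) => n /asboolP [b [Ib b0 vb]] minn.
exists (b :: lb); split=> [d /= [<- //|]|w /= [<- _|lw Fw]]; first exact: lbI.
  exists b; split=> //; first by left.
  move=> q Iq q0; have /minn := vI q Iq q0; rewrite vb => nq.
  by rewrite -(gez0_abs (krull_val_ge0 Fv (IA _ Iq) q0)) lez_nat.
by have [d [lbd d0 dP]] := lbP w lw Fw; exists d; split=> //; right.
Qed.

(** If everything carrying [I] into [A] were in [A], the same would hold for the ideal generated by
    [a :: lb]; its v-closure, and so [I], would contain [1]. *)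
Lemma krull_t_ideal_colon : exists x, (forall q, I q -> A (x * q)) /\ ~ A x.
Proof.
apply/not_notP => nx; apply: I1.
have [[IA _] [[a [Ia a0]] _]] := tI.
have [l al] := finF a0; have [lb [lbI lbP]] := krull_t_ideal_minima l.
apply: (t_ideal_vclos (l := a :: lb) tI).
- by move=> b /= [<- //|]; exact: lbI.
- by exists a; split=> //; left.
move=> x xl; rewrite mul1r; apply/not_notP => nAx; apply: nx; exists x; split=> //.
have [x0 _] := krull_notinP nAx.
move=> q Iq; have [->|q0] := eqVneq q 0; first by rewrite mulr0; exact: (subr_0 hA).
apply: krull_memP => [|v Fv]; first by rewrite mulf_neq0.
have dv := dF Fv; rewrite (valM dv) //.
(* Where [v a = 0], the generator [a] already forces [v x >= 0]. Each other [v] is in [l], and a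
   generator of least value bounds [v (x * q)] from below. *)
have [va|va] := eqVneq (v a) 0.
  have := krull_val_ge0 Fv (xl a (or_introl erefl)) (mulf_neq0 x0 a0).
  rewrite (valM dv) // va addr0 => vx.
  by rewrite addr_ge0 // krull_val_ge0 //; exact: IA.
have [b [lb_b b0 bq]] := lbP v (al v Fv va) Fv.
apply: le_trans (_ : v x + v b <= _); last by rewrite lerD2l; exact: bq.
by rewrite -(valM dv) // krull_val_ge0 ?mulf_neq0 //; apply: xl; right.
Qed.

(** If every such [x] mapped [I] into itself, all [x ^+ n * a] would lie in [I], and complete
    integral closedness would put [x] in [A]. *)
Lemma krull_t_ideal_multiplier :
  exists x p, [/\ I p, ~ I (x * p) & forall q, I q -> A (x * q)].
Proof.
have [x [xI nAx]] := krull_t_ideal_colon; apply/not_notP => np; apply: nAx.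
have [[IA _] [[a [Ia a0]] _]] := tI.
apply: (krull_completely_integrally_closed (a := a)) => // [|n]; first exact: IA.
apply: IA; elim: n => [|n IHn]; first by rewrite mul1r.
rewrite exprS -mulrA; apply/not_notP => nI; apply: np.
by exists x, (x ^+ n * a).
Qed.

End TIdeal.

(* In other words [A_P] is the intersection of the [V_v], [v] in [F], with
   [v s = 0] for all [s] outside [P]. *)
Lemma krull_notin_loc (P : K -> Prop) x : is_prime_ideal A P ->
  ~ localization A P x ->
  exists2 v, F v & v x < 0 /\ forall s, A s -> ~ P s -> v s = 0.
Proof.
move=> hP nPx; have [[PA [P0 _]] [P1 _]] := hP.
have neq0 s : ~ P s -> s != 0 by move=> Ps; apply: contra_not_neq Ps => ->.
have [x0 _] : x != 0 /\ exists2 v, F v & v x < 0.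
  by apply: krull_notinP => Ax; apply: nPx; exact: sub_loc.
apply/not_notP => nv; apply: nPx; have [l xl] := finF x0.
(* Only finitely many valuations are nonzero at [x]; [s] is built by clearing the negative ones in
   turn, which harms no earlier one since elements of [A] have nonnegative values. *)
have [s [As Ps sl]] : exists s, [/\ A s, ~ P s &
    forall v, List.In v l -> F v -> 0 <= v (s * x)].
  elim: l {xl} => [|v l [s [As Ps sl]]].
    by exists 1; split=> //; exact: (subr_1 hA).
  have s0 := neq0 _ Ps.
  have [Fv|nFv] := pselect (F v); last first.
    by exists s; split=> // w /= [<- //|]; exact: sl.
  have [vx|vx] := leP 0 (v x).
    exists s; split=> // w /= [<- _|]; last exact: sl.
    by rewrite (valM (dF Fv)) // addr_ge0 // krull_val_ge0.
  (* Without such a [t], this [v] would be the valuation sought. As [v t >= 1], the power [|v x|] of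
     [t] compensates [v x]. *)
  have [t [At Pt vt]] : exists t, [/\ A t, ~ P t & 0 < v t].
    apply/not_notP => nt; apply: nv; exists v => //; split=> // t At Pt.
    apply/eqP; rewrite eq_le (krull_val_ge0 Fv At (neq0 _ Pt)) andbT leNgt.
    by apply/negP => vt; apply: nt; exists t.
  have t0 := neq0 _ Pt.
  have Atn : A (t ^+ `|v x|) by exact: (subr_X hA).
  have tn0 : t ^+ `|v x| != 0 by rewrite expf_neq0.
  exists (t ^+ `|v x| * s); split; first exact: (subr_M hA).
    by apply: (prime_idealM hP) => // /(prime_idealX hP At).
  move=> w lw Fw; have dw := dF Fw.
  have ws := krull_val_ge0 Fw As s0.
  rewrite -mulrA (valM dw) ?mulf_neq0 //.
  case: lw => [vw|lw]; last by rewrite addr_ge0 ?sl // krull_val_ge0.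
  rewrite (valM dw) // (valX dw) // -vw; rewrite -vw in ws.
  by move: (v x) (v t) (v s) vx vt ws => i j k; nia.
apply/(locP _ hP); exists s; split=> //; have s0 := neq0 _ Ps.
apply: krull_memP => [|v Fv]; first by rewrite mulf_neq0.
have [vx|/(xl v Fv) lv] := eqVneq (v x) 0; last exact: sl.
by rewrite (valM (dF Fv)) // vx addr0 krull_val_ge0.
Qed.

(** * The t-primes of a Krull domain and their localizations *)

Section TPrime.
Variable P : K -> Prop.
Hypothesis tP : is_t_prime A P.

(** A denominator [s] of [x] outside [P] would give [s * (x * p) = (s * x) * p] in [P], with neither
    [s] nor [x * p] in [P]. *)
Lemma krull_t_prime_multiplier : exists x p,
  [/\ P p, ~ P (x * p), forall q, P q -> A (x * q) & ~ localization A P x].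
Proof.
have [hP tidP] := tP; have [[_ [_ [_ PM]]] [P1 pP]] := hP.
have [x [p [Pp nP xP]]] := krull_t_ideal_multiplier tidP P1.
exists x, p; split=> // /(locP _ hP) [s [As Ps Asx]].
have : P (s * (x * p)) by rewrite mulrA; exact: PM.
by case/pP => //; exact: xP.
Qed.

Lemma krull_t_prime_loc :
  exists2 v, F v & forall x, localization A P x <-> val_ring v x.
Proof.
have [hP tidP] := tP; have [[PA [P0 [_ PM]]] [P1 pP]] := hP.
have neq0 s : ~ P s -> s != 0 by move=> Ps; apply: contra_not_neq Ps => ->.
have [x [p [Pp nP xP nlx]]] := krull_t_prime_multiplier.
have p0 : p != 0 by apply: contra_not_neq nP => ->; rewrite mulr0.
have x0 : x != 0 by apply: contra_not_neq nP => ->; rewrite mul0r.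
have [v Fv [vx vs]] := krull_notin_loc hP nlx; have dv := dF Fv.
have vp : 0 < v p.
  have := krull_val_ge0 Fv (xP p Pp) (mulf_neq0 x0 p0).
  by rewrite (valM dv) //; lia.
(* [p] generates [P A_P], so elements of [A] are powers of [p] up to units. *)
have pdec N b : A b -> b != 0 -> (`|v b| < N)%N ->
    exists n s t, [/\ A s, ~ P s, A t, ~ P t & s * b = t * p ^+ n].
  elim: N b => // N IHN b Ab b0 vbN.
  have [Pb|Pb] := pselect (P b); last first.
    exists 0, 1, b; split=> //; first exact: (subr_1 hA).
    by rewrite mul1r mulr1.
  (* Multiplication by [x] keeps [b] in [A] and lowers its value; since [x * p] is outside [P], it
     costs one factor [p] up to a unit at [P]. *)
  have [||n [s [t [As Ps At Pt E]]]] := IHN (x * b) (xP b Pb).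
  - by rewrite mulf_neq0.
  - have := krull_val_ge0 Fv (xP b Pb) (mulf_neq0 x0 b0).
    by rewrite (valM dv) //; move: (v x) (v b) vx vbN => i j; lia.
  exists n.+1, (s * (x * p)), t; split=> //.
  - by apply: (subr_M hA) => //; exact: xP.
  - by apply: (prime_idealM hP) => //; exact: xP.
  - by rewrite exprSr [RHS]mulrA -E; ring.
exists v => // y; have [->|y0] := eqVneq y 0.
  by split=> _; [left|apply: sub_loc => //; exact: (subr_0 hA)].
rewrite val_ring_ge0 //; split=> [/(locP _ hP) [s [As Ps Asy]]|vy].
  have := krull_val_ge0 Fv Asy (mulf_neq0 (neq0 _ Ps) y0).
  by rewrite (valM dv) ?(neq0 _ Ps) // vs // add0r.
have [b [c [Ab [Ac [c0 yE]]]]] := hK y.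
have b0 : b != 0 by apply: contraNneq y0 => b0; rewrite yE b0 mul0r.
have [n [s [t [As Ps At Pt E]]]] := pdec _ _ Ab b0 (ltnSn _).
have [m [s' [t' [As' Ps' At' Pt' E']]]] := pdec _ _ Ac c0 (ltnSn _).
have [s0 t0 s'0 t'0] : [/\ s != 0, t != 0, s' != 0 & t' != 0] by split; exact: neq0.
have Ey : s * t' * y * p ^+ m = t * s' * p ^+ n.
  transitivity (s * b * s'); last by rewrite E; ring.
  by rewrite mulrAC -[s * t' * _]mulrA -E' yE; field.
(* All of [s], [t], [s'], [t'] have value [0], so [0 <= v y] compares the exponents of [p]. *)
have mn : (m <= n)%N.
  have := congr1 v Ey; rewrite !(valM dv) ?mulf_neq0 ?expf_neq0 //.
  rewrite !(valX dv) // (vs s) // (vs t) // (vs s') // (vs t') //.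
  rewrite -lez_nat -(ler_pM2l vp).
  by move: (v p * m) (v p * n) (v y) vy => i j k; lia.
apply/(locP _ hP); exists (s * t'); split; [exact: (subr_M hA)|exact: (prime_idealM hP)|].
have -> : s * t' * y = t * s' * p ^+ (n - m).
  apply: (mulIf (expf_neq0 m p0)); rewrite Ey -[in LHS](subnK mn) exprD mulrA //.
by apply: (subr_M hA); [exact: (subr_M hA)|apply: (subr_X hA); exact: PA].
Qed.

End TPrime.

(** The value group at [Q] has rank one: for nonzero [p] in [P] and [q] in [Q], a power of [q] is a
    multiple of [p] in the localization at [Q], and primality of [P] gives [q] in [P]. *)
Lemma krull_t_prime_incomparable (P Q : K -> Prop) :
  is_t_prime A P -> is_t_prime A Q -> (forall x, P x -> Q x) ->
  forall x, Q x -> P x.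
Proof.
move=> [hP [_ [[p [Pp p0]] _]]] tQ PQ q Qq.
have [hQ _] := tQ; have [[QA _] _] := hQ.
have [[PA [P0 [_ PM]]] [_ pP]] := hP.
have [->|q0] := eqVneq q 0; first exact: P0.
have Aq := QA _ Qq.
have [v Fv vQ] := krull_t_prime_loc tQ; have dv := dF Fv.
have vq : 0 < v q.
  rewrite ltNge; apply/negP => vq.
  apply: (loc_inv hQ Aq q0).1 => //; apply/vQ; right.
  by rewrite (valV dv) // oppr_ge0.
have vp := krull_val_ge0 Fv (PA _ Pp) p0.
have /vQ /(locP _ hQ) [s [As Qs As']] : val_ring v (q ^+ `|v p| / p).
  right; rewrite (valM dv) ?invr_neq0 ?expf_neq0 // (valX dv) // (valV dv) //.
  by move: (v p) (v q) vp vq => i j; nia.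
have : P (s * q ^+ `|v p|).
  have -> : s * q ^+ `|v p| = s * (q ^+ `|v p| / p) * p by rewrite -!mulrA mulVf // mulr1.
  exact: PM.
by case/pP => [||/PQ|/(prime_idealX hP Aq)] //; exact: (subr_X hA).
Qed.

End KrullFamily.

(** * Krull domains are almost Krull and have the t##-property *)

Lemma Krull_almost_Krull : Krull A -> almost_Krull A.
Proof.
move=> [F [dF [AF finF]]] M /t_max_prime tM.
have [v Fv vM] := krull_t_prime_loc dF AF finF tM.
by exists v; split=> //; exact: dF.
Qed.

Lemma Krull_t_sharp_sharp : Krull A -> t_sharp_sharp A.
Proof.
move=> [F [dF [AF finF]]] F1 F2 tF1 tF2 _ _ dF12 eqF12.
wlog [P F1P nF2P] : F1 F2 tF1 tF2 eqF12 {dF12} / exists2 P, F1 P & ~ F2 P.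
  case: dF12 => P [[F1P nF2P]|[F2P nF1P]] wl.
    by apply: (wl F1 F2) => //; exists P.
  apply: (wl F2 F1) => //; last by exists P.
  by move=> x; split=> /eqF12.
have [x [p [Pp _ xP nPx]]] := krull_t_prime_multiplier dF AF finF (tF1 _ F1P).
apply/nPx/((eqF12 x).2 _ P F1P) => Q F2Q; have tQ := tF2 _ F2Q.
have [hP _] := tF1 _ F1P; have [hQ _] := tQ.
(* Otherwise [P] is contained in [Q], hence equal to it by incomparability, and so belongs to [F2].
   Such an [s] is a denominator of [x] outside [Q]. *)
have [s Ps Qs] : exists2 s, P s & ~ Q s.
  apply/not_notP => ns; have PQ s : P s -> Q s.
    by move=> Ps; apply/not_notP => Qs; apply: ns; exists s.
  apply: nF2P; suff -> : P = Q by [].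
  apply/funext => s; apply/propext; split; first exact: PQ.
  exact: (krull_t_prime_incomparable dF AF finF (tF1 _ F1P) tQ PQ).
apply/(locP _ hQ); exists s; split=> //; last by rewrite mulrC; exact: xP.
by case: hP => [[PA _] _]; exact: PA.
Qed.

End Domain.

Theorem theorem1p17 (K : fieldType) (A : K -> Prop)
  (hsub : subring A) (hqf : quotient_field_of A) (hneq : exists x, ~ A x) :
  (almost_Krull A /\ t_sharp A <-> almost_Krull A /\ t_sharp_sharp A) /\
  (almost_Krull A /\ t_sharp_sharp A <-> Krull A).
Proof.
have ss_s : t_sharp_sharp A -> t_sharp A by exact: t_sharp_sharp_sharp.
have s_Kr : almost_Krull A /\ t_sharp A -> Krull A.
  by case; exact: almost_Krull_t_sharp_Krull.
have Kr_ss : Krull A -> almost_Krull A /\ t_sharp_sharp A.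
  by move=> KrA; split; [exact: Krull_almost_Krull|exact: Krull_t_sharp_sharp].
split; split.
- by move/s_Kr/Kr_ss.
- by case=> aK /ss_s.
- by case=> aK /ss_s ts; exact: s_Kr.
- exact: Kr_ss.
Qed.
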